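(* Let $S,Q\in\mathbb{C}^{\nu\times\nu}$ be diagonalizable, $L\in\mathbb{C}^{p\times\nu}$, $R\in\mathbb{C}^{\nu\times q}$, with $(L,S)$ observable, $(Q,R)$ controllable, $\sigma(S)\cap\Omega=\emptyset$ and $\sigma(Q)\cap\Omega=\emptyset$, and let $\Pi\in\mathbb{C}^{n\times\nu}$, $\Upsilon\in\mathbb{C}^{\nu\times n}$ be the unique solutions of $$M\Pi S^2+D\Pi S+K\Pi=BL,\qquad Q^2\Upsilon M+Q\Upsilon D+\Upsilon K=RC_0+QRC_1.$$ Consider a reduced second-order model $\widehat\Sigma$: $F_2\ddot\xi+F_1\dot\xi+F_0\xi=Gu$, $\psi=H_1\dot\xi+H_0\xi$, whose pencil is regular, i.e. $\det(F_2s^2+F_1s+F_0)\not\equiv0$. (1) If $\sigma(S)\cap\widehat\Omega=\emptyset$, then $\widehat\Sigma$ matches the right tangential moments encoded by $(S,L)$ if and only if $$C_0\Pi+C_1\Pi S=H_0P_r+H_1P_rS,$$ where $P_r$ is the unique solution of $F_2P_rS^2+F_1P_rS+F_0P_r=GL$. (2) If $\sigma(Q)\cap\widehat\Omega=\emptyset$, then $\widehat\Sigma$ matches the left tangential moments encoded by $(Q,R)$ if and only if $$\Upsilon B=P_lG,$$ where $P_l$ is the unique solution of $Q^2P_lF_2+QP_lF_1+P_lF_0=RH_0+QRH_1$.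
   Context: The original system is the second-order system with $p$ inputs and $q$ outputs $M\ddot x+D\dot x+Kx=Bu$, $y=C_1\dot x+C_0x$, with $M,D,K\in\mathbb{R}^{n\times n}$, $M$ nonsingular, $B\in\mathbb{R}^{n\times p}$, $C_0,C_1\in\mathbb{R}^{q\times n}$, transfer matrix $W(s)=(C_1s+C_0)(Ms^2+Ds+K)^{-1}B$, and $\Omega=\{s\in\mathbb{C}:\det(Ms^2+Ds+K)=0\}$. The reduced model has $F_i\in\mathbb{R}^{\nu\times\nu}$, $G\in\mathbb{R}^{\nu\times p}$, $H_0,H_1\in\mathbb{R}^{q\times\nu}$, transfer matrix $\widehat W(s)=(H_1s+H_0)(F_2s^2+F_1s+F_0)^{-1}G$, and $\widehat\Omega=\{s\in\mathbb{C}:\det(F_2s^2+F_1s+F_0)=0\}$. The right tangential moments encoded by $(S,L)$ are the vectors $W(s_i)\ell_i$ with $Sv_i=s_iv_i$, $v_i\ne0$, $\ell_i=Lv_i$; $\widehat\Sigma$ matches them if $\widehat W(s_i)\ell_i=W(s_i)\ell_i$ for all such eigenpairs. The left tangential moments encoded by $(Q,R)$ are the row vectors $\rho_j^\ast W(\mu_j)$ with $w_j^\ast Q=\mu_jw_j^\ast$, $w_j\neq 0$, $\rho_j^\ast=w_j^\ast R$; $\widehat\Sigma$ matches them if $\rho_j^\ast\widehat W(\mu_j)=\rho_j^\ast W(\mu_j)$ for all such pairs. *)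

(* Defs.v *)
From HB Require Import structures.
From mathcomp Require Import all_boot all_order all_algebra.
From mathcomp Require Import spectral.
From mathcomp Require Import complex.
From mathcomp Require Import boolp classical_sets reals.

Set Implicit Arguments.
Unset Strict Implicit.
Unset Printing Implicit Defensive.

Import Order.TTheory GRing.Theory Num.Theory.

Local Open Scope classical_set_scope.
Local Open Scope ring_scope.
Local Open Scope complex_scope.
Local Open Scope sesquilinear_scope.

Definition toC (RT : realType) (m n : nat) (A : 'M[RT]_(m, n)) : 'M[RT[i]]_(m, n) :=
  map_mx (real_complex RT) A.

Definition qpencil (RT : realType) (n : nat) (A2 A1 A0 : 'M[RT]_n) (s : RT[i]) :
    'M[RT[i]]_n :=
  s ^+ 2 *: toC A2 + s *: toC A1 + toC A0.

Definition regular_pencil (RT : realType) (n : nat) (A2 A1 A0 : 'M[RT]_n) : Prop :=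
  exists s : RT[i], \det (qpencil A2 A1 A0 s) <> 0.

Definition pencil_zeros (RT : realType) (n : nat) (A2 A1 A0 : 'M[RT]_n) :
    set RT[i] :=
  [set s | \det (qpencil A2 A1 A0 s) = 0].

(* The transfer matrix of A2 x'' + A1 x' + A0 x = B u, y = C1 x' + C0 x. It is
   meaningful only outside pencil_zeros A2 A1 A0, since invmx is the identity
   function on singular matrices. *)
Definition transfer (RT : realType) (n p q : nat) (A2 A1 A0 : 'M[RT]_n)
    (B : 'M[RT]_(n, p)) (C1 C0 : 'M[RT]_(q, n)) (s : RT[i]) : 'M[RT[i]]_(q, p) :=
  (s *: toC C1 + toC C0) *m invmx (qpencil A2 A1 A0 s) *m toC B.

Definition spectrum (RT : realType) (n : nat) (A : 'M[RT[i]]_n) : set RT[i] :=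
  [set s | eigenvalue A s].

(* Kalman rank conditions, on [L; L S; ...; L S^(n-1)] and
   [R, Q R, ..., Q^(n-1) R] respectively. *)
Definition observable (RT : realType) (n p : nat) (L : 'M[RT[i]]_(p, n))
    (S : 'M[RT[i]]_n) : Prop :=
  \rank (\mxcol_(k < n) (L *m S ^+ k)) = n.

Definition controllable (RT : realType) (n q : nat) (Q : 'M[RT[i]]_n)
    (R : 'M[RT[i]]_(n, q)) : Prop :=
  \rank (\mxrow_(k < n) (Q ^+ k *m R)) = n.

Definition matches_right (RT : realType) (nu p q : nat)
    (What W : RT[i] -> 'M[RT[i]]_(q, p))
    (S : 'M[RT[i]]_nu) (L : 'M[RT[i]]_(p, nu)) : Prop :=
  forall (s : RT[i]) (v : 'cV[RT[i]]_nu),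
    v <> 0 -> S *m v = s *: v -> What s *m (L *m v) = W s *m (L *m v).

(* w^t* is the conjugate transpose, i.e. a left (row) eigenvector of Q. *)
Definition matches_left (RT : realType) (nu p q : nat)
    (What W : RT[i] -> 'M[RT[i]]_(q, p))
    (Q : 'M[RT[i]]_nu) (R : 'M[RT[i]]_(nu, q)) : Prop :=
  forall (mu : RT[i]) (w : 'cV[RT[i]]_nu),
    w <> 0 -> w^t* *m Q = mu *: w^t* ->
    (w^t* *m R) *m What mu = (w^t* *m R) *m W mu.

Definition right_sylvester (RT : realType) (n nu p : nat) (A2 A1 A0 : 'M[RT]_n)
    (B : 'M[RT]_(n, p)) (S : 'M[RT[i]]_nu) (L : 'M[RT[i]]_(p, nu))
    (X : 'M[RT[i]]_(n, nu)) : Prop :=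
  toC A2 *m X *m S ^+ 2 + toC A1 *m X *m S + toC A0 *m X = toC B *m L.

Definition left_sylvester (RT : realType) (n nu q : nat) (A2 A1 A0 : 'M[RT]_n)
    (C1 C0 : 'M[RT]_(q, n)) (Q : 'M[RT[i]]_nu) (R : 'M[RT[i]]_(nu, q))
    (Y : 'M[RT[i]]_(nu, n)) : Prop :=
  Q ^+ 2 *m Y *m toC A2 + Q *m Y *m toC A1 + Y *m toC A0
  = R *m toC C0 + Q *m R *m toC C1.

(* Main.v *)
(* Applying the right Sylvester equation to an eigenvector v of S with eigenvalue
   s decouples it into (A2 s^2 + A1 s + A0) X v = B L v, so (C0 X + C1 X S) v is
   exactly the moment of the transfer matrix at s in the direction L v; dually,
   w Y B is the left moment for a left eigenvector w of Q. As the eigenvectors of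
   a diagonalizable matrix span the space, two models share all moments iff the
   corresponding matrices agree. The right-hand case is reduced to the left-hand
   one by transposition. *)
Require Import Defs.
From HB Require Import structures.
From mathcomp Require Import all_boot all_order all_algebra.
From mathcomp Require Import spectral.
From mathcomp Require Import complex.
From mathcomp Require Import boolp classical_sets reals.

Set Implicit Arguments.
Unset Strict Implicit.
Unset Printing Implicit Defensive.

Import Order.TTheory GRing.Theory Num.Theory.

Local Open Scope classical_set_scope.
Local Open Scope ring_scope.
Local Open Scope complex_scope.

(** * Bases of left eigenvectors *)

Lemma diagonalizable_eigenrows (F : fieldType) (n : nat) (A : 'M[F]_n) :
  diagonalizable A ->
  exists2 P, P \in unitmx & exists d : 'rV[F]_n, P *m A = diag_mx d *m P.
Proof.
by case=> P uP /similar_diagPex [d /(similarP uP) PA]; exists P => //; exists d.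
Qed.

Lemma eigenrow_neq0 (F : fieldType) (n : nat) (P : 'M[F]_n) (i : 'I_n) :
  P \in unitmx -> row i P != 0.
Proof.
rewrite -row_free_unit => /row_freeP [P' PP']; apply/eqP => Pi0.
have /rowP/(_ i) := congr1 (row i) PP'.
by rewrite row_mul Pi0 mul0mx !mxE eqxx => /esym/eqP; rewrite oner_eq0.
Qed.

Lemma row_eigenrows (F : fieldType) (n : nat) (A P : 'M[F]_n) (d : 'rV[F]_n) i :
  P *m A = diag_mx d *m P -> row i P *m A = d 0 i *: row i P.
Proof. by move=> PA; rewrite -row_mul PA row_mul row_diag_mx -scalemxAl -rowE. Qed.

(** Left multiplication by the invertible eigenrow matrix [P] is injective, so [X] and [Y] may be
    compared through the rows of [P *m X] and [P *m Y]. *)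
Lemma eq_on_eigenrows (F : fieldType) (n m : nat) (A : 'M[F]_n)
    (X Y : 'M[F]_(n, m)) :
  diagonalizable A ->
  (forall (a : F) (u : 'rV_n), u != 0 -> u *m A = a *: u -> u *m X = u *m Y) ->
  X = Y.
Proof.
move=> /diagonalizable_eigenrows [P uP [d PA]] XY.
apply: (can_inj (mulKmx uP)); apply/row_matrixP => i; rewrite !row_mul.
by apply: XY (row_eigenrows i PA); apply: eigenrow_neq0.
Qed.

(** Transposing [P *m A = diag_mx d *m P] shows that the inverse of [P^T] diagonalizes [A^T], with
    the same [d]. *)
Lemma diagonalizable_trmx (F : fieldType) (n : nat) (A : 'M[F]_n) :
  diagonalizable A -> diagonalizable A^T.
Proof.
move=> /diagonalizable_eigenrows [P uP [d PA]].
have uPt : invmx P^T \in unitmx by rewrite unitmx_inv unitmx_tr.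
exists (invmx P^T) => //; apply/similar_diagPex; exists d.
apply/(similarP uPt); apply: (can_inj (mulKVmx uPt)); rewrite invmxK.
rewrite !mulmxA mulmxV ?unitmx_tr // mul1mx.
by rewrite -[in RHS](tr_diag_mx d) -trmx_mul -PA trmx_mul mulmxK // unitmx_tr.
Qed.

Lemma eigenvalue_trmx (F : fieldType) (n : nat) (A : 'M[F]_n) (a : F) :
  eigenvalue A^T a = eigenvalue A a.
Proof.
rewrite !eigenvalue_root_char /char_poly -[in RHS]det_tr /char_poly_mx.
by rewrite linearB /= tr_scalar_mx map_trmx.
Qed.

(** * Solvability of the quadratic Sylvester equations *)

Lemma eigenrow_sylvester (F : fieldType) (n m : nat) (A2 A1 A0 : 'M[F]_n)
    (Q : 'M[F]_m) (Y : 'M[F]_(m, n)) (a : F) (u : 'rV[F]_m) :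
  u *m Q = a *: u ->
  u *m (Q ^+ 2 *m Y *m A2 + Q *m Y *m A1 + Y *m A0)
  = u *m Y *m (a ^+ 2 *: A2 + a *: A1 + A0).
Proof.
move=> uQ; rewrite !mulmxDr -!scalemxAr !mulmxA.
by rewrite !uQ -!scalemxAl !uQ -!scalemxAl scalerA -expr2.
Qed.

(** In a basis of eigenrows of [Q] the equation splits into one linear system per row, whose matrix
    is the pencil at the corresponding eigenvalue. *)
Lemma quadratic_sylvester_unique (F : fieldType) (n m : nat)
    (A2 A1 A0 : 'M[F]_n) (Q : 'M[F]_m) (E : 'M[F]_(m, n)) :
  diagonalizable Q ->
  (forall a, eigenvalue Q a -> a ^+ 2 *: A2 + a *: A1 + A0 \in unitmx) ->
  exists! Y, Q ^+ 2 *m Y *m A2 + Q *m Y *m A1 + Y *m A0 = E.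
Proof.
move=> dQ uA; have [P uP [d PQ]] := diagonalizable_eigenrows dQ.
pose Z a := a ^+ 2 *: A2 + a *: A1 + A0.
(* Row [i] of [P *m Y] has to be [row i P *m E] times the inverse of the pencil at [d 0 i]; the
   factor [invmx P] returns to the original basis. *)
exists (invmx P *m \matrix_i (row i P *m E *m invmx (Z (d 0 i)))); split.
  apply: (can_inj (mulKmx uP)); apply/row_matrixP => i; rewrite !(row_mul i P).
  have Pi := row_eigenrows i PQ.
  rewrite (eigenrow_sylvester _ _ _ _ Pi) -[row i P *m (invmx P *m _)]row_mul mulKVmx //.
  rewrite rowK mulmxKV //; apply/uA/eigenvalueP.
  by exists (row i P) => //; apply: eigenrow_neq0.
move=> Y YE; apply: (can_inj (mulKmx uP)); rewrite mulKVmx //.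
apply/row_matrixP => i; rewrite rowK row_mul -YE.
rewrite (eigenrow_sylvester _ _ _ _ (row_eigenrows i PQ)) mulmxK //.
apply/uA/eigenvalueP.
by exists (row i P); [exact: row_eigenrows | exact: eigenrow_neq0].
Qed.

Lemma unitmx_qpencil (RT : realType) (n m : nat) (A2 A1 A0 : 'M[RT]_n)
    (Q : 'M[RT[i]]_m) (a : RT[i]) :
  spectrum Q `&` pencil_zeros A2 A1 A0 = set0 -> eigenvalue Q a ->
  qpencil A2 A1 A0 a \in unitmx.
Proof.
move=> disj Qa; rewrite unitmxE unitfE; apply/eqP => det0.
by have : set0 a by rewrite -disj.
Qed.

Lemma left_sylvester_unique (RT : realType) (n nu q : nat)
    (A2 A1 A0 : 'M[RT]_n) (C1 C0 : 'M[RT]_(q, n))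
    (Q : 'M[RT[i]]_nu) (R : 'M[RT[i]]_(nu, q)) :
  diagonalizable Q -> spectrum Q `&` pencil_zeros A2 A1 A0 = set0 ->
  exists! Y, left_sylvester A2 A1 A0 C1 C0 Q R Y.
Proof.
move=> dQ disj; apply: quadratic_sylvester_unique => // a Qa.
exact: unitmx_qpencil Qa.
Qed.

(** Transposition moves [S] to the left of the unknown, which brings the right equation under the
    results on eigenrows. *)
Lemma right_sylvester_tr (RT : realType) (n nu p : nat)
    (A2 A1 A0 : 'M[RT]_n) (B : 'M[RT]_(n, p))
    (S : 'M[RT[i]]_nu) (L : 'M[RT[i]]_(p, nu)) (X : 'M[RT[i]]_(n, nu)) :
  right_sylvester A2 A1 A0 B S L X <->
  S^T ^+ 2 *m X^T *m toC A2^T + S^T *m X^T *m toC A1^T + X^T *m toC A0^T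
  = (toC B *m L)^T.
Proof.
have -> : S^T ^+ 2 *m X^T *m toC A2^T + S^T *m X^T *m toC A1^T
    + X^T *m toC A0^T
  = (toC A2 *m X *m S ^+ 2 + toC A1 *m X *m S + toC A0 *m X)^T.
  by rewrite /toC !expr2 -!map_trmx !linearD /= !trmx_mul !mulmxA.
by split=> [->|/trmx_inj].
Qed.

Lemma qpencil_tr (RT : realType) (n : nat) (A2 A1 A0 : 'M[RT]_n) (s : RT[i]) :
  qpencil A2^T A1^T A0^T s = (qpencil A2 A1 A0 s)^T.
Proof. by rewrite /qpencil /toC !linearD !linearZ /= !map_trmx. Qed.

Lemma right_sylvester_unique (RT : realType) (n nu p : nat)
    (A2 A1 A0 : 'M[RT]_n) (B : 'M[RT]_(n, p))
    (S : 'M[RT[i]]_nu) (L : 'M[RT[i]]_(p, nu)) :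
  diagonalizable S -> spectrum S `&` pencil_zeros A2 A1 A0 = set0 ->
  exists! X, right_sylvester A2 A1 A0 B S L X.
Proof.
move=> dS disj.
have [||Y [YE Yuniq]] := @quadratic_sylvester_unique _ _ _ (toC A2^T) (toC A1^T)
    (toC A0^T) S^T (toC B *m L)^T; first exact: diagonalizable_trmx.
  move=> a; rewrite eigenvalue_trmx => Sa.
  have := unitmx_qpencil disj Sa; rewrite -unitmx_tr -qpencil_tr; exact.
exists Y^T; split; first by apply/right_sylvester_tr; rewrite trmxK.
by move=> X /right_sylvester_tr /Yuniq ->; rewrite trmxK.
Qed.

(** * Moments in terms of Sylvester solutions *)

(** Writing [A(a)] for the pencil, the Sylvester equation multiplied by [u] reads
    [u R (a C1 + C0) = u Y A(a)], and [A(a)] cancels against its inverse in the transfer matrix. *)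
Lemma left_moment (RT : realType) (n nu p q : nat)
    (A2 A1 A0 : 'M[RT]_n) (B : 'M[RT]_(n, p)) (C1 C0 : 'M[RT]_(q, n))
    (Q : 'M[RT[i]]_nu) (R : 'M[RT[i]]_(nu, q)) (Y : 'M[RT[i]]_(nu, n))
    (a : RT[i]) (u : 'rV[RT[i]]_nu) :
  spectrum Q `&` pencil_zeros A2 A1 A0 = set0 ->
  left_sylvester A2 A1 A0 C1 C0 Q R Y ->
  u != 0 -> u *m Q = a *: u ->
  u *m R *m transfer A2 A1 A0 B C1 C0 a = u *m (Y *m toC B).
Proof.
move=> disj YE u0 uQ; have := eigenrow_sylvester (toC A2) (toC A1) (toC A0) Y uQ.
rewrite YE mulmxDr !mulmxA uQ -!scalemxAl => uY.
(* The row [u] puts [a] in the spectrum of [Q], hence off the pencil zeros, so [invmx] is a genuine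
   inverse here. *)
have uA : qpencil A2 A1 A0 a \in unitmx.
  by apply: unitmx_qpencil disj _; apply/eigenvalueP; exists u.
rewrite /transfer mulmxDr -scalemxAr addrC uY.
by rewrite mulmxK.
Qed.

Lemma right_moment (RT : realType) (n nu p q : nat)
    (A2 A1 A0 : 'M[RT]_n) (B : 'M[RT]_(n, p)) (C1 C0 : 'M[RT]_(q, n))
    (S : 'M[RT[i]]_nu) (L : 'M[RT[i]]_(p, nu)) (X : 'M[RT[i]]_(n, nu))
    (a : RT[i]) (v : 'cV[RT[i]]_nu) :
  spectrum S `&` pencil_zeros A2 A1 A0 = set0 ->
  right_sylvester A2 A1 A0 B S L X ->
  v != 0 -> S *m v = a *: v ->
  transfer A2 A1 A0 B C1 C0 a *m (L *m v)
  = (toC C0 *m X + toC C1 *m X *m S) *m v.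
Proof.
move=> disj /right_sylvester_tr XE v0 Sv.
have vS : v^T *m S^T = a *: v^T by rewrite -trmx_mul Sv linearZ.
have := eigenrow_sylvester (toC A2^T) (toC A1^T) (toC A0^T) X^T vS.
(* Transposing back, [BLv] says that [B L v] is the pencil at [a] applied to [X v]. *)
rewrite XE -/(qpencil _ _ _ _) qpencil_tr -!trmx_mul => /trmx_inj BLv.
have uA : qpencil A2 A1 A0 a \in unitmx.
  apply: unitmx_qpencil disj _; rewrite -eigenvalue_trmx; apply/eigenvalueP.
  by exists v^T; rewrite // -(inj_eq (@trmx_inj _ _ _)) trmxK trmx0.
rewrite /transfer -!mulmxA [toC B *m _]mulmxA BLv mulKmx //.
by rewrite !mulmxDl -!mulmxA Sv -!scalemxAr -scalemxAl addrC.
Qed.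

(** * Moment matching as a matrix identity *)

Lemma matches_right_iff (RT : realType) (n n' nu p q : nat)
    (A2 A1 A0 : 'M[RT]_n) (B : 'M[RT]_(n, p)) (C1 C0 : 'M[RT]_(q, n))
    (A2' A1' A0' : 'M[RT]_n') (B' : 'M[RT]_(n', p)) (C1' C0' : 'M[RT]_(q, n'))
    (S : 'M[RT[i]]_nu) (L : 'M[RT[i]]_(p, nu))
    (X : 'M[RT[i]]_(n, nu)) (X' : 'M[RT[i]]_(n', nu)) :
  diagonalizable S ->
  spectrum S `&` pencil_zeros A2 A1 A0 = set0 ->
  spectrum S `&` pencil_zeros A2' A1' A0' = set0 ->
  right_sylvester A2 A1 A0 B S L X ->
  right_sylvester A2' A1' A0' B' S L X' ->
  matches_right (transfer A2' A1' A0' B' C1' C0') (transfer A2 A1 A0 B C1 C0) S L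
  <-> toC C0 *m X + toC C1 *m X *m S = toC C0' *m X' + toC C1' *m X' *m S.
Proof.
move=> dS disj disj' XE XE'; split=> [match_|eqCX a v /eqP v0 Sv]; last first.
  by rewrite (right_moment _ _ disj XE) // (right_moment _ _ disj' XE') // eqCX.
(* The eigenrows of [S^T] are the transposes of the right eigenvectors of [S], so the row criterion
   applies to the transposed identity. *)
apply/trmx_inj/(eq_on_eigenrows (diagonalizable_trmx dS)) => a u u0 uS.
have v0 : u^T != 0 by rewrite -(inj_eq (@trmx_inj _ _ _)) trmxK trmx0.
have Sv : S *m u^T = a *: u^T by apply: trmx_inj; rewrite trmx_mul linearZ /= trmxK.
apply: trmx_inj; rewrite !trmx_mul !trmxK.
rewrite -(right_moment _ _ disj XE v0 Sv) -(right_moment _ _ disj' XE' v0 Sv).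
by apply/esym/match_ => //; apply/eqP.
Qed.

Lemma matches_left_iff (RT : realType) (n n' nu p q : nat)
    (A2 A1 A0 : 'M[RT]_n) (B : 'M[RT]_(n, p)) (C1 C0 : 'M[RT]_(q, n))
    (A2' A1' A0' : 'M[RT]_n') (B' : 'M[RT]_(n', p)) (C1' C0' : 'M[RT]_(q, n'))
    (Q : 'M[RT[i]]_nu) (R : 'M[RT[i]]_(nu, q))
    (Y : 'M[RT[i]]_(nu, n)) (Y' : 'M[RT[i]]_(nu, n')) :
  diagonalizable Q ->
  spectrum Q `&` pencil_zeros A2 A1 A0 = set0 ->
  spectrum Q `&` pencil_zeros A2' A1' A0' = set0 ->
  left_sylvester A2 A1 A0 C1 C0 Q R Y ->
  left_sylvester A2' A1' A0' C1' C0' Q R Y' ->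
  matches_left (transfer A2' A1' A0' B' C1' C0') (transfer A2 A1 A0 B C1 C0) Q R
  <-> Y *m toC B = Y' *m toC B'.
Proof.
move=> dQ disj disj' YE YE'; split=> [match_|eqYB a w w0 wQ]; last first.
  have u0 : (w^t* != 0)%sesqui.
    by apply/eqP => u0; apply: w0; rewrite -[w]trmxCK u0 trmx0 map_mx0.
  by rewrite (left_moment _ disj YE u0 wQ) (left_moment _ disj' YE' u0 wQ) eqYB.
apply: (eq_on_eigenrows dQ) => a u u0 uQ.
rewrite -(left_moment _ disj YE u0 uQ) -(left_moment _ disj' YE' u0 uQ).
(* Conjugate transposition is an involution, so every eigenrow [u] of [Q] has the form [w^t*]
   required by [matches_left], with [w] equal to [u^t*]. *)
have := match_ a (u^t*)%sesqui; rewrite trmxCK => ->//.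
by move=> w0; move/eqP: u0; apply; rewrite -[u]trmxCK w0 trmx0 map_mx0.
Qed.

Theorem proposition8 (RT : realType) (n p q nu : nat)
    (M D K : 'M[RT]_n) (B : 'M[RT]_(n, p)) (C1 C0 : 'M[RT]_(q, n))
    (S Q : 'M[RT[i]]_nu) (L : 'M[RT[i]]_(p, nu)) (R : 'M[RT[i]]_(nu, q))
    (F2 F1 F0 : 'M[RT]_nu) (G : 'M[RT]_(nu, p)) (H1 H0 : 'M[RT]_(q, nu)) :
  M \in unitmx ->
  diagonalizable S ->
  diagonalizable Q ->
  observable L S ->
  controllable Q R ->
  spectrum S `&` pencil_zeros M D K = set0 ->
  spectrum Q `&` pencil_zeros M D K = set0 ->
  regular_pencil F2 F1 F0 ->
  (exists! Pi, right_sylvester M D K B S L Pi) /\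
  (exists! Upsilon, left_sylvester M D K C1 C0 Q R Upsilon) /\
  forall (Pi : 'M[RT[i]]_(n, nu)) (Upsilon : 'M[RT[i]]_(nu, n)),
    right_sylvester M D K B S L Pi ->
    left_sylvester M D K C1 C0 Q R Upsilon ->
    (spectrum S `&` pencil_zeros F2 F1 F0 = set0 ->
      (exists! Pr, right_sylvester F2 F1 F0 G S L Pr) /\
      forall Pr : 'M[RT[i]]_nu, right_sylvester F2 F1 F0 G S L Pr ->
        (matches_right (transfer F2 F1 F0 G H1 H0) (transfer M D K B C1 C0) S L
         <-> toC C0 *m Pi + toC C1 *m Pi *m S
             = toC H0 *m Pr + toC H1 *m Pr *m S)) /\
    (spectrum Q `&` pencil_zeros F2 F1 F0 = set0 ->
      (exists! Pl, left_sylvester F2 F1 F0 H1 H0 Q R Pl) /\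
      forall Pl : 'M[RT[i]]_nu, left_sylvester F2 F1 F0 H1 H0 Q R Pl ->
        (matches_left (transfer F2 F1 F0 G H1 H0) (transfer M D K B C1 C0) Q R
         <-> Upsilon *m toC B = Pl *m toC G)).
Proof.
move=> _ dS dQ _ _ S0 Q0 _; split; first exact: right_sylvester_unique.
split; first exact: left_sylvester_unique.
move=> Pi Upsilon PiE UE; split=> [S0'|Q0'].
  (* The uniqueness lemmas hold for an arbitrary pencil, so they serve the reduced model as well as
     the original system. *)
  split; first exact: right_sylvester_unique.
  by move=> Pr PrE; apply: matches_right_iff.
split; first exact: left_sylvester_unique.
by move=> Pl PlE; apply: matches_left_iff UE PlE.
Qed.
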